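(* Let $M$ be a smooth compact manifold without boundary of dimension $n\ge 3$ and let $(g,V,c)$ be a Yamabe soliton on $M$, i.e. $g$ is a Riemannian metric, $V$ a smooth vector field and $c\in\mathbb{R}$ a constant with $\mathcal{L}_V g = 2(R-c)\,g$, where $R$ is the scalar curvature of $g$. If there is a constant $\alpha>0$ with $R\ge \alpha$ on $M$, then $c\ge \alpha$, and the soliton is expanding (i.e. $c>0$).
   Context: A Yamabe soliton $(g,V,c)$ on a manifold $M^n$ consists of a complete Riemannian metric $g$, a smooth vector field $V$ (the soliton vector field) and a real constant $c$ (the soliton constant) satisfying $\mathcal{L}_V g_{ij} = 2(-c+R)g_{ij}$, where $\mathcal{L}_V$ is the Lie derivative along $V$ and $R$ is the scalar curvature of $g$. (On a compact manifold every metric is complete.) The soliton is called shrinking, steady or expanding according as $c<0$, $c=0$ or $c>0$ respectively. *)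

(* Defs.v *)
From mathcomp Require Import all_boot all_order all_algebra.
From mathcomp Require Import all_classical all_reals all_analysis.

Set Implicit Arguments.
Unset Strict Implicit.
Unset Printing Implicit Defensive.

Import Order.TTheory GRing.Theory Num.Theory.
Import numFieldNormedType.Exports.

Local Open Scope classical_set_scope.
Local Open Scope ring_scope.

(* Points of R^n are row vectors, so 'J f x acts on tangent vectors from the
   right: 'D_v f x = v *m 'J f x. *)

Definition partial (R : realType) (n : nat) (W : normedModType R) (k : 'I_n)
    (f : 'rV[R]_n -> W) : 'rV[R]_n -> W :=
  fun x => 'D_(delta_mx 0 k) f x.

Definition iter_partial (R : realType) (n : nat) (W : normedModType R)
    (s : seq 'I_n) (f : 'rV[R]_n -> W) : 'rV[R]_n -> W :=
  foldr (fun k h => partial k h) f s.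

(* C^oo on U, meant for U open: the derivatives at a point of U then depend
   only on the values of f in U. *)
Definition smooth_on (R : realType) (n : nat) (W : normedModType R)
    (U : set 'rV[R]_n) (f : 'rV[R]_n -> W) : Prop :=
  forall (s : seq 'I_n) (x : 'rV[R]_n), U x ->
    {for x, continuous (iter_partial s f)} /\
    forall k : 'I_n, derivable (iter_partial s f) x (delta_mx 0 k).

(* A homeomorphism between an open subset of M and an open subset of R^n; the
   values of coord outside dom and of chart_inv outside coord @` dom are junk. *)
Record chart (R : realType) (n : nat) (M : topologicalType) := Chart {
  dom : set M;
  coord : M -> 'rV[R]_n;
  chart_inv : 'rV[R]_n -> M;
  open_dom : open dom;
  open_image : open (coord @` dom);
  coordK : forall p, dom p -> chart_inv (coord p) = p;
  coord_cont : {within dom, continuous coord};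
  chart_inv_cont : {within coord @` dom, continuous chart_inv} }.

Definition image_dom (R : realType) (n : nat) (M : topologicalType)
    (phi : chart R n M) : set 'rV[R]_n := coord phi @` dom phi.

Definition overlap (R : realType) (n : nat) (M : topologicalType)
    (phi psi : chart R n M) : set 'rV[R]_n :=
  coord phi @` (dom phi `&` dom psi).

Definition transition (R : realType) (n : nat) (M : topologicalType)
    (phi psi : chart R n M) : 'rV[R]_n -> 'rV[R]_n :=
  coord psi \o chart_inv phi.

(* All charts map onto open subsets of R^n: there is no boundary. The atlas is
   not required to be maximal. *)
Record smooth_manifold (R : realType) (n : nat) (M : topologicalType) :=
  SmoothManifold {
    chart_index : Type;
    atlas :> chart_index -> chart R n M;
    atlas_cover : forall p : M, exists a, dom (atlas a) p;
    atlas_smooth : forall a b,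
      smooth_on (overlap (atlas a) (atlas b)) (transition (atlas a) (atlas b));
    manifold_hausdorff : hausdorff_space M;
    manifold_second_countable : @second_countable M }.

(* The components of the field in each chart, as functions of the coordinates,
   subject to the contravariant transformation law. *)
Record vector_field (R : realType) (n : nat) (M : topologicalType)
    (S : smooth_manifold R n M) := VectorField {
  vf_comp :> chart_index S -> 'rV[R]_n -> 'rV[R]_n;
  vf_smooth : forall a, smooth_on (image_dom (S a)) (vf_comp a);
  vf_change : forall a b x, overlap (S a) (S b) x ->
    vf_comp b (transition (S a) (S b) x) =
      vf_comp a x *m 'J (transition (S a) (S b)) x }.

(* The Gram matrix (g_ij) of the coordinate frame in each chart, subject to the
   covariant transformation law. *)
Record riemannian_metric (R : realType) (n : nat) (M : topologicalType)
    (S : smooth_manifold R n M) := RiemannianMetric {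
  metric_comp :> chart_index S -> 'rV[R]_n -> 'M[R]_n;
  metric_smooth : forall a, smooth_on (image_dom (S a)) (metric_comp a);
  metric_sym : forall a x, image_dom (S a) x ->
    (metric_comp a x)^T = metric_comp a x;
  metric_posdef : forall a x, image_dom (S a) x ->
    forall u : 'rV[R]_n, u != 0 -> 0 < (u *m metric_comp a x *m u^T) 0 0;
  metric_change : forall a b x, overlap (S a) (S b) x ->
    metric_comp a x =
      'J (transition (S a) (S b)) x
        *m metric_comp b (transition (S a) (S b) x)
        *m ('J (transition (S a) (S b)) x)^T }.

Section coordinate_expressions.
Variables (R : realType) (n : nat).
Implicit Types (g : 'rV[R]_n -> 'M[R]_n) (v : 'rV[R]_n -> 'rV[R]_n).
Implicit Types (x : 'rV[R]_n) (i j k l : 'I_n).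

(* Gamma^k_ij of the Levi-Civita connection *)
Definition christoffel g k i j x : R :=
  2^-1 * \sum_(l < n) invmx (g x) k l *
    (partial i (fun y => g y j l) x + partial j (fun y => g y i l) x
     - partial l (fun y => g y i j) x).

(* R^l_kij, where
   Rm(d_i, d_j) d_k = nabla_i nabla_j d_k - nabla_j nabla_i d_k
                    = \sum_l R^l_kij d_l *)
Definition riemann g l k i j x : R :=
  partial i (christoffel g l j k) x - partial j (christoffel g l i k) x
  + \sum_(m < n) (christoffel g l i m x * christoffel g m j k x
                  - christoffel g l j m x * christoffel g m i k x).

(* Ric(Y, Z) = tr (X |-> Rm(X, Y) Z); positive on round spheres *)
Definition ricci g j k x : R := \sum_(i < n) riemann g i k i j x.

Definition scalar_curvature g x : R :=
  \sum_(j < n) \sum_(k < n) invmx (g x) j k * ricci g j k x.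

(* (L_v g)(d_i, d_j) = v (g_ij) - g([v, d_i], d_j) - g(d_i, [v, d_j]) with
   [v, d_i] = - \sum_k (d_i v^k) d_k *)
Definition lie_derivative v g x : 'M[R]_n :=
  \matrix_(i, j) \sum_(k < n)
    (v x 0 k * partial k (fun y => g y i j) x
     + g x k j * partial i (fun y => v y 0 k) x
     + g x i k * partial j (fun y => v y 0 k) x).

End coordinate_expressions.

Section soliton.
Variables (R : realType) (n : nat) (M : topologicalType).
Variable S : smooth_manifold R n M.

(* The scalar curvature at p, computed in a chart a around p; by naturality it
   does not depend on a, and it is used below only through statements
   quantified over all charts around p. *)
Definition scal (g : riemannian_metric S) (a : chart_index S) (p : M) : R :=
  scalar_curvature (g a) (coord (S a) p).

Definition yamabe_soliton (g : riemannian_metric S) (V : vector_field S)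
    (c : R) : Prop :=
  forall (a : chart_index S) (p : M), dom (S a) p ->
    lie_derivative (V a) (g a) (coord (S a) p) =
      (2 * (scal g a p - c)) *: g a (coord (S a) p).

Definition scal_ge (g : riemannian_metric S) (alpha : R) : Prop :=
  forall (a : chart_index S) (p : M), dom (S a) p -> alpha <= scal g a p.

End soliton.

(* In the convention L_V g = 2 (scal - c) g, expanding means c > 0. *)
Definition expanding (R : realType) (c : R) : Prop := 0 < c.

(* Main.v *)
Require Import Defs.
From mathcomp Require Import all_boot all_order all_algebra.
From mathcomp Require Import all_classical all_reals all_analysis.
From mathcomp Require Import ring.

Set Implicit Arguments.
Unset Strict Implicit.
Unset Printing Implicit Defensive.

Import Order.TTheory GRing.Theory Num.Theory.
Import numFieldNormedType.Exports.

Local Open Scope classical_set_scope.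
Local Open Scope ring_scope.

(** Suppose c < alpha. Then f = 2 (R - c) is positive everywhere and V satisfies
    L_V g = f g, so the flow of V would strictly expand all lengths of the
    compact manifold M. The usual way to exclude this is to integrate
    div V = n (R - c) over M; a maximum principle for the function g(V, V) does
    it as well, and needs neither integration nor a flow.

    As [V, V] = 0, differentiating g(V, V) along V gives
      V (g(V, V)) = (L_V g)(V, V) = f g(V, V)
    ([lie_derivative_sqnorm]). The function g(V, V) does not depend on the chart
    ([sqnorm_change]), so it is a continuous function on M and has a maximum by
    compactness ([sqnorm_max]). All its partial derivatives vanish there
    ([derive_local_max]), hence f g(V, V) = 0, and the maximum of g(V, V) is 0
    because f > 0. Thus V = 0 on M, so f g = L_V g = 0, which is absurd
    ([no_conformal_expansion]). *)

(** Fermat's rule in one direction: the difference quotients are nonpositive for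
    small positive increments and nonnegative for small negative ones. *)
Lemma derive_local_max (R : realFieldType) (W : normedModType R) (f : W -> R)
    (x v : W) :
  derivable f x v -> (\forall y \near x, f y <= f x) -> 'D_v f x = 0.
Proof.
move=> dfx maxf.
have maxv : \forall t \near (0 : R), f (t *: v + x) <= f x.
  have : (fun t : R => t *: v + x) @ (0 : R) --> x.
    rewrite -[X in _ --> X]add0r -[X in X + x](scale0r v).
    by apply: cvgD; [apply: cvgZr_tmp; exact: cvg_id | exact: cvg_cst].
  by move=> /(_ _ maxf).
apply/eqP; rewrite eq_le; apply/andP; split.
  rewrite /derive cvg_at_rightE; last exact: dfx.
  apply: limr_le.
    rewrite -cvg_at_rightE //; apply: cvg_trans dfx; apply: cvg_app.
    move=> A [e egt0 Ae]; exists e => // t te tgt0; apply: Ae => //.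
    exact/lt0r_neq0.
  near=> t; apply: mulr_ge0_le0.
    by rewrite invr_ge0; apply: ltW; near: t; exists 1 => /=.
  by rewrite subr_le0 /=; near: t; exact: cvg_within maxv.
rewrite /derive cvg_at_leftE; last exact: dfx.
apply: limr_ge.
  rewrite -cvg_at_leftE //; apply: cvg_trans dfx; apply: cvg_app.
  move=> A [e egt0 Ae]; exists e => // t te tgt0; apply: Ae => //.
  exact/ltr0_neq0.
near=> t; apply: mulr_le0.
  by rewrite invr_le0; apply: ltW; near: t; exists 1 => /=.
by rewrite subr_le0 /=; near: t; exact: cvg_within maxv.
Unshelve. all: by end_near. Qed.

(** The function g(v, v) in coordinates, g being given by its Gram matrix. *)
Definition sqnorm (R : realType) (n : nat) (v : 'rV[R]_n -> 'rV[R]_n)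
    (g : 'rV[R]_n -> 'M[R]_n) (x : 'rV[R]_n) : R :=
  (v x *m g x *m (v x)^T) 0 0.

Lemma mulmx_form (R : comPzRingType) (n : nat) (u w : 'rV[R]_n) (A : 'M[R]_n) :
  (u *m A *m w^T) 0 0 = \sum_(i < n) \sum_(j < n) u 0 i * A i j * w 0 j.
Proof.
rewrite mxE exchange_big /=; apply: eq_bigr => j _.
by rewrite !mxE mulr_suml; apply: eq_bigr => i _.
Qed.

Lemma sqnormE (R : realType) (n : nat) (v : 'rV[R]_n -> 'rV[R]_n)
    (g : 'rV[R]_n -> 'M[R]_n) :
  sqnorm v g = \sum_(i < n) \sum_(j < n)
    ((fun y => v y 0 i) * (fun y => g y i j) * (fun y => v y 0 j)).
Proof.
apply/funext => x; rewrite /sqnorm mulmx_form fct_sumE; apply: eq_bigr => i _.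
by rewrite fct_sumE.
Qed.

Lemma is_derive_sqnorm (R : realType) (n : nat) (v : 'rV[R]_n -> 'rV[R]_n)
    (g : 'rV[R]_n -> 'M[R]_n) (x e : 'rV[R]_n) :
  derivable v x e -> derivable g x e ->
  is_derive x e (sqnorm v g) (\sum_(i < n) \sum_(j < n)
    ('D_e (fun y => v y 0 i) x * g x i j * v x 0 j
     + v x 0 i * 'D_e (fun y => g y i j) x * v x 0 j
     + v x 0 i * g x i j * 'D_e (fun y => v y 0 j) x)).
Proof.
move=> /derivable_mxP dv /derivable_mxP dg; rewrite sqnormE.
apply: is_derive_sum => i; apply: is_derive_sum => j.
have dvi := derivableP (dv 0 i); have dvj := derivableP (dv 0 j).
have dgij := derivableP (dg i j).
apply: is_derive_eq; rewrite !fctE /= /GRing.scale /=; ring.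
Qed.

(** Exchange of summations matching, up to the names of the indices, the three
    terms of the product rule for g(v, v) with those of the Lie derivative. *)
Lemma sum3_reindex (A : nmodType) (n : nat) (P Q T : 'I_n -> 'I_n -> 'I_n -> A) :
  \sum_(k < n) \sum_(i < n) \sum_(j < n) P i j k +
  \sum_(k < n) \sum_(i < n) \sum_(j < n) Q k j i +
  \sum_(k < n) \sum_(i < n) \sum_(j < n) T i k j =
  \sum_(i < n) \sum_(j < n) \sum_(k < n) (P i j k + Q i j k + T i j k).
Proof.
under [RHS]eq_bigr do under eq_bigr do rewrite !big_split /=.
under [RHS]eq_bigr do rewrite !big_split /=.
rewrite !big_split /=; congr (_ + _ + _).
- rewrite exchange_big /=; apply: eq_bigr => i _.
  by rewrite exchange_big.
- by apply: eq_bigr => i _; rewrite exchange_big.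
- by rewrite exchange_big.
Qed.

(** The identity V (g(V, V)) = (L_V g)(V, V): the remaining term 2 g([V, V], V)
    of the Leibniz rule vanishes. The left-hand side is a sum of partial
    derivatives, not the directional derivative along v x: the two agree for
    differentiable components, but the product rule in the coordinate directions
    gives the former at once. *)
Lemma lie_derivative_sqnorm (R : realType) (n : nat)
    (v : 'rV[R]_n -> 'rV[R]_n) (g : 'rV[R]_n -> 'M[R]_n) (x : 'rV[R]_n) :
  (forall k, derivable v x (delta_mx 0 k)) ->
  (forall k, derivable g x (delta_mx 0 k)) ->
  \sum_(k < n) v x 0 k * partial k (sqnorm v g) x =
    (v x *m lie_derivative v g x *m (v x)^T) 0 0.
Proof.
move=> dv dg.
pose P i j k := v x 0 i * v x 0 j * v x 0 k * partial k (fun y => g y i j) x.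
pose Q i j k := v x 0 i * v x 0 j * g x k j * partial i (fun y => v y 0 k) x.
pose T i j k := v x 0 i * v x 0 j * g x i k * partial j (fun y => v y 0 k) x.
transitivity (\sum_(k < n) \sum_(i < n) \sum_(j < n) P i j k +
              \sum_(k < n) \sum_(i < n) \sum_(j < n) Q k j i +
              \sum_(k < n) \sum_(i < n) \sum_(j < n) T i k j).
  rewrite -!big_split; apply: eq_bigr => k _ /=.
  rewrite {1}/partial (@derive_val _ _ _ _ _ _ _ (is_derive_sqnorm (dv k) (dg k))).
  rewrite mulr_sumr -!big_split; apply: eq_bigr => i _ /=.
  rewrite mulr_sumr -!big_split; apply: eq_bigr => j _ /=.
  rewrite /P /Q /T /partial; ring.
rewrite sum3_reindex mulmx_form; apply: eq_bigr => i _; apply: eq_bigr => j _.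
rewrite mxE mulr_sumr mulr_suml; apply: eq_bigr => k _.
rewrite /P /Q /T; ring.
Qed.

Local Notation dom := Defs.dom.
Local Notation coord := Defs.coord.

Section charts.
Variables (R : realType) (n : nat) (M : topologicalType).
Variable S : smooth_manifold R n M.
Implicit Types (a b : chart_index S) (p : M).

Lemma transition_coord a b p :
  dom (S a) p -> transition (S a) (S b) (coord (S a) p) = coord (S b) p.
Proof. by move=> ap; rewrite /transition /= coordK. Qed.

(** The Jacobian of the change of charts enters g covariantly and V
    contravariantly, so it cancels in g(V, V). *)
Lemma sqnorm_change (g : riemannian_metric S) (V : vector_field S) a b p :
  dom (S a) p -> dom (S b) p ->
  sqnorm (V a) (g a) (coord (S a) p) = sqnorm (V b) (g b) (coord (S b) p).
Proof.
move=> ap bp.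
have ab : overlap (S a) (S b) (coord (S a) p) by exists p.
rewrite /sqnorm (metric_change g ab) -(transition_coord b ap) (vf_change V ab).
by rewrite trmx_mul !mulmxA.
Qed.

Lemma coord_continuous_at a p :
  dom (S a) p -> {for p, continuous (coord (S a))}.
Proof.
move=> ap; have := @coord_cont _ _ _ (S a).
by rewrite continuous_open_subspace; [apply; rewrite inE | exact: open_dom].
Qed.

Lemma sqnorm_continuous_at (g : riemannian_metric S) (V : vector_field S)
    a (x : 'rV[R]_n) :
  image_dom (S a) x -> {for x, continuous (sqnorm (V a) (g a))}.
Proof.
move=> ax; have [/= cV _] := vf_smooth V [::] ax.
have [/= cg _] := metric_smooth g [::] ax.
have cVi i : V a y 0 i @[y --> x] --> V a x 0 i.
  exact: (cvg_comp _ _ cV (@coord_continuous _ _ _ _ _ _)).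
have cgij i j : g a y i j @[y --> x] --> g a x i j.
  exact: (cvg_comp _ _ cg (@coord_continuous _ _ _ _ _ _)).
rewrite (_ : sqnorm _ _ = fun y => \sum_(i < n) \sum_(j < n)
    (V a y 0 i * g a y i j * V a y 0 j)); last first.
  by apply/funext => y; rewrite /sqnorm mulmx_form.
apply: cvg_big => [||i _]; first exact: add_continuous.
  exact: nbhs_filter.
apply: cvg_big => [||j _]; first exact: add_continuous.
  exact: nbhs_filter.
exact: (cvgM (cvgM (cVi i) (cgij i j)) (cVi j)).
Qed.

Lemma sqnorm_le0 (g : riemannian_metric S) (V : vector_field S)
    a (x : 'rV[R]_n) :
  image_dom (S a) x -> sqnorm (V a) (g a) x <= 0 -> V a x = 0.
Proof.
move=> ax; apply: contraTeq => V0; rewrite -ltNge; exact: metric_posdef.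
Qed.

(** By [sqnorm_change] the local functions g(V, V) glue to a function on M, which
    is continuous because it can be computed near p in a fixed chart; so it
    attains its maximum on the compact M. *)
Lemma sqnorm_max (g : riemannian_metric S) (V : vector_field S) :
  compact [set: M] -> [set: M] !=set0 ->
  exists p a, dom (S a) p /\
    forall q b, dom (S b) q ->
      sqnorm (V b) (g b) (coord (S b) q) <= sqnorm (V a) (g a) (coord (S a) p).
Proof.
move=> cM M0; have [ch chP] := choice (atlas_cover S).
pose h p := sqnorm (V (ch p)) (g (ch p)) (coord (S (ch p)) p).
have hE a p : dom (S a) p -> h p = sqnorm (V a) (g a) (coord (S a) p).
  by move=> ap; apply: sqnorm_change.
have cont_h : continuous h.
  move=> p; pose a := ch p; have ap : dom (S a) p := chP p.
  have near_h : {near p, sqnorm (V a) (g a) \o coord (S a) =1 h}.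
    have := open_nbhs_nbhs (conj (open_dom (S a)) ap).
    by apply: filterS => q aq; rewrite /= -hE.
  rewrite /continuous_at /prop_for; apply: (cvg_trans (near_eq_cvg near_h)).
  rewrite (hE a)//; apply: continuous_comp; first exact: coord_continuous_at.
  by apply: sqnorm_continuous_at; exists p.
have [p _ pmax] := compact_EVT_max M0 cM (continuous_subspaceT cont_h).
exists p, (ch p); split=> // q b bq.
by rewrite -(hE b)// -(hE (ch p))//; apply: pmax; rewrite inE.
Qed.

(** A compact manifold carries no infinitesimal conformal expansion: at a
    maximum of g(V, V) the identity of [lie_derivative_sqnorm] reads
    0 = f g(V, V), so this maximum is 0, V vanishes identically, and then
    0 = L_V g = f g contradicts f > 0 in positive dimension. *)
Lemma no_conformal_expansion (g : riemannian_metric S)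
    (V : vector_field S) (f : chart_index S -> M -> R) :
  (0 < n)%N -> compact [set: M] -> [set: M] !=set0 ->
  (forall a p, dom (S a) p ->
     lie_derivative (V a) (g a) (coord (S a) p) = f a p *: g a (coord (S a) p))
  -> ~ (forall a p, dom (S a) p -> 0 < f a p).
Proof.
move=> n_gt0 cM M0 LVg f_gt0.
have [p [a [ap pmax]]] := sqnorm_max g V cM M0.
set x := coord (S a) p in pmax.
have ax : image_dom (S a) x by exists p.
have near_ax : \forall y \near x, image_dom (S a) y.
  exact: (open_nbhs_nbhs (conj (@open_image _ _ _ (S a)) ax)).
have [/= _ dV] := vf_smooth V [::] ax.
have [/= _ dg] := metric_smooth g [::] ax.
have crit k : partial k (sqnorm (V a) (g a)) x = 0.
  apply: derive_local_max.
    by have [] := is_derive_sqnorm (dV k) (dg k).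
  by apply: filterS near_ax => _ [q aq <-]; exact: pmax.
have norm0 : sqnorm (V a) (g a) x = 0.
  have := lie_derivative_sqnorm dV dg.
  rewrite big1 => [|k _]; last by rewrite crit mulr0.
  rewrite LVg// -scalemxAr -scalemxAl mxE => /esym/eqP.
  by rewrite mulf_eq0 gt_eqF ?f_gt0//= => /eqP.
have V0 y : image_dom (S a) y -> V a y = 0.
  move=> ay; apply: (sqnorm_le0 (g := g)) => //.
  by have [q aq <-] := ay; rewrite (le_trans (pmax _ _ aq))// norm0.
have L0 : lie_derivative (V a) (g a) x = 0.
  have partialV0 i k : partial i (fun y => V a y 0 k) x = 0.
    rewrite /partial (@near_eq_derive _ _ _ _ (cst 0)) ?derive_cst//.
    by apply: filterS near_ax => y /V0 ->; rewrite mxE.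
  apply/matrixP => i j; rewrite !mxE big1// => k _.
  by rewrite !partialV0 (V0 x)// mxE !mulr0 mul0r !addr0.
have /eqP := L0; rewrite LVg// scaler_eq0 gt_eqF ?f_gt0//= => /eqP g0.
have := @metric_posdef _ _ _ _ g a x ax (delta_mx 0 (Ordinal n_gt0)).
rewrite g0 mulmx0 mul0mx mxE ltxx => /(_ _)/notF; apply.
by apply/eqP => /matrixP/(_ 0 (Ordinal n_gt0))/eqP; rewrite !mxE !eqxx oner_eq0.
Qed.

End charts.

Theorem theorem2p1 (R : realType) (n : nat) (hn : (3 <= n)%N)
  (M : topologicalType) (S : smooth_manifold R n M)
  (M_compact : compact [set: M]) (M_nonempty : [set: M] !=set0)
  (g : riemannian_metric S) (V : vector_field S) (c : R)
  (gVc : yamabe_soliton g V c)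
  (alpha : R) (alpha_gt0 : 0 < alpha) (scal_ge_alpha : scal_ge g alpha) :
  alpha <= c /\ expanding c.
Proof.
suff alpha_le_c : alpha <= c by split=> //; exact: lt_le_trans alpha_le_c.
have n_gt0 : (0 < n)%N by exact: ltn_trans hn.
rewrite leNgt; apply/negP => c_lt_alpha.
apply: (no_conformal_expansion n_gt0 M_compact M_nonempty gVc).
move=> a p /scal_ge_alpha alpha_le; rewrite mulr_gt0// subr_gt0.
exact: lt_le_trans alpha_le.
Qed.
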